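(* For $n<\omega$ let $\mathcal{A}_n=\{X\in P(n)\mid |X\cap\mathbb{N}_e|=\frac{n}{4}=|X\cap\mathbb{N}_o|\}$ (so $\mathcal{A}_n=\emptyset$ if $4\nmid n$), and let $\vec{\mathcal{A}}=\langle\mathcal{A}_n\mid n<\omega\rangle$. Then $|\mathcal{A}_n|=\binom{n/2}{n/4}^2$ for every $n$ divisible by $4$, and $\mathbb{P}_0(\mathrm{G}(\vec{\mathcal{A}}))=1$.
   Context: $\mathbb{N}_e$ and $\mathbb{N}_o$ denote the sets of even and odd natural numbers (with $0$ even). Each $n<\omega$ is identified with $\{0,\dots,n-1\}$, and $P(\omega)$ is identified with $2^\omega$ via indicator functions. $\mathbb{P}_0$ is the standard Borel probability measure on $2^\omega$, determined by $\mathbb{P}_0(C_t)=2^{-|t|}$ for $t\in 2^{<\omega}$, where $C_t$ is the set of $f\in 2^\omega$ extending $t$ (the fair coin-flipping measure). For a sequence $\vec{\mathcal{A}}=\langle\mathcal{A}_n\mid n<\omega\rangle$ with $\mathcal{A}_n\subseteq P(n)$, the set of guessed reals is $\mathrm{G}(\vec{\mathcal{A}})=\{X\in P(\omega)\mid X\cap n\in\mathcal{A}_n\text{ for infinitely many }n\}$. *)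

(* Defs.v *)
From HB Require Import structures.
From mathcomp Require Import all_boot all_order all_algebra.
From mathcomp Require Import zify lra.
From mathcomp Require Import all_classical all_reals all_analysis.

Set Implicit Arguments.
Unset Strict Implicit.
Unset Printing Implicit Defensive.

Import Order.TTheory GRing.Theory Num.Theory.
Import numFieldNormedType.Exports.

Local Open Scope classical_set_scope.
Local Open Scope ring_scope.

(* [cantor_space] is 2^omega with the product topology; a real X : nat -> bool
   is the indicator function of a subset of omega. *)
Notation borel_cantor := (g_sigma_algebraType (@open cantor_space)).

Definition cylinder (t : seq bool) : set cantor_space :=
  [set f | forall i, (i < size t)%N -> f i = nth false t i].

(* X :&: n, as a subset of n = {0, ..., n-1} *)
Definition initial_segment (X : cantor_space) (n : nat) : {set 'I_n} :=
  [set i : 'I_n | X i].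

Definition guessed_reals (A : forall n, {set {set 'I_n}}) : set cantor_space :=
  [set X | infinite_set [set n | initial_segment X n \in A n]].

(* n / 4 is an exact quotient, not the truncated one: the equations are stated
   in rat, so that no X qualifies unless 4 divides n. *)
Definition balanced_quarter (n : nat) : {set {set 'I_n}} :=
  [set X : {set 'I_n} |
    (#|X :&: [set i : 'I_n | ~~ odd i]|%:R == n%:R / 4 :> rat) &&
    (n%:R / 4 == #|X :&: [set i : 'I_n | odd i]|%:R :> rat)].

Lemma cylinderE t f : cylinder t f <-> mkseq f (size t) = t.
Proof.
split=> [h|h i it].
  apply: (@eq_from_nth _ false); rewrite size_mkseq// => i it.
  by rewrite nth_mkseq// h.
by rewrite -[X in nth _ X]h nth_mkseq.
Qed.

Lemma mem_cylinder_mkseq (f g : nat -> bool) n :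
  cylinder (mkseq f n) g <-> forall i, (i < n)%N -> g i = f i.
Proof.
rewrite /cylinder/= size_mkseq; split=> h i iN; first by rewrite h// nth_mkseq.
by rewrite nth_mkseq// h.
Qed.

Lemma open_coord (i : nat) (b : bool) : open [set f : cantor_space | f i = b].
Proof.
have ci : continuous ((fun f => f i) : cantor_space -> bool).
  exact: (@proj_continuous nat (fun=> bool : topologicalType) i).
by move/continuousP : ci => /(_ [set b]); apply; exact: discrete_open.
Qed.

Lemma open_cylinder t : open (cylinder t).
Proof.
have -> : cylinder t =
    \bigcap_(i in `I_(size t)) [set f : cantor_space | f i = nth false t i].
  by apply/seteqP; split => f h i /h.
rewrite bigcap_mkord.
elim/big_ind : _ => [|A B oA oB|i _]; [exact: openT|exact: openI|].
exact: open_coord.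
Qed.

Lemma cylinder_nbhs (f : cantor_space) (U : set cantor_space) :
  open U -> U f -> exists n, cylinder (mkseq f n) `<=` U.
Proof.
move=> oU Uf.
pose B n := cylinder (mkseq f n).
have FF : Filter (filter_from setT B).
  apply: filter_from_filter; first by exists 0%N.
  move=> m n _ _; exists (maxn m n) => // g /mem_cylinder_mkseq h.
  by split; apply/mem_cylinder_mkseq => i im; apply: h;
    rewrite leq_max im ?orbT.
have cvf : filter_from setT B --> f.
  apply/cvg_sup => i A.
  rewrite nbhsE /= => -[_ [[C oC <-] Cf] CA].
  exists i.+1 => // g /mem_cylinder_mkseq h; apply: CA => /=.
  by rewrite /preimage/= h.
by have [|n _ BU] := cvf U; [exact: open_nbhs_nbhs|exists n].
Qed.

Lemma open_bigcup_cylinder (U : set cantor_space) : open U ->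
  U = \bigcup_(t in [set t | cylinder t `<=` U]) cylinder t.
Proof.
move=> oU; apply/seteqP; split => [f /(cylinder_nbhs oU)[n nU]|f [t /= + tf]].
  by exists (mkseq f n) => //; apply/mem_cylinder_mkseq.
exact.
Qed.

Lemma sigma_cylinder : <<s @open cantor_space >> = <<s range cylinder >>.
Proof.
apply/seteqP; split; apply: smallest_sub; try exact: smallest_sigma_algebra.
- move=> U /open_bigcup_cylinder ->; rewrite bigcup_mkcond.
  pose T := g_sigma_algebraType (range cylinder).
  apply: (@countable_bigcupT_measurable _ T) => // t.
  case: ifPn => _; last exact: (@measurable0 _ T).
  by apply: sub_sigma_algebra; exists t.
- by move=> _ [t _ <-]; apply: sub_sigma_algebra; exact: open_cylinder.
Qed.

Lemma measurable_cylinder t : measurable (cylinder t : set borel_cantor).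
Proof. by apply: sub_sigma_algebra; exact: open_cylinder. Qed.

Section binary_expansion.
Variable R : realType.
Implicit Types (x y : R) (n : nat) (t : seq bool).

Definition binary_digits x : cantor_space :=
  fun n => odd (Num.truncn (2 ^+ n.+1 * x)).

Definition binary_value t : nat := foldl (fun k (b : bool) => (k.*2 + b)%N) 0%N t.

Lemma binary_value_rcons t b :
  binary_value (rcons t b) = ((binary_value t).*2 + b)%N.
Proof. by rewrite /binary_value foldl_rcons. Qed.

Lemma binary_value_lt t : (binary_value t < 2 ^ size t)%N.
Proof.
elim/last_ind: t => // t b ih; rewrite binary_value_rcons size_rcons expnS.
rewrite mul2n -(leq_add2l 1) !add1n -(leq_double) in ih *.
by case: b; rewrite ?addn1 ?addn0 -?doubleS; [exact: ih|exact: ltnW].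
Qed.

Lemma binary_value_inj s t :
  size s = size t -> binary_value s = binary_value t -> s = t.
Proof.
elim/last_ind: s t => [|s b ih] t; elim/last_ind: t => [|t c _]//;
  rewrite ?size_rcons// => -[st]; rewrite !binary_value_rcons => E.
have bc : b = c by have := congr1 odd E; rewrite !oddD !odd_double !oddb.
by move: E; rewrite bc => /addIn/double_inj/ih ->.
Qed.

Lemma truncn_half y : 0 <= y -> (Num.truncn (2 * y))./2 = Num.truncn y.
Proof.
move=> y0; apply/esym/truncn_def.
have /truncn_itv : 0 <= 2 * y by rewrite mulr_ge0.
move: (Num.truncn _) => m.
have mE : (m%:R : R) = (odd m)%:R + m./2%:R * 2.
  by rewrite -natrM -natrD muln2 odd_double_half.
rewrite -[m.+1]addn1 -[m./2.+1]addn1 !natrD mE.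
by case: (odd m) => /= /andP[? ?]; apply/andP; split; lra.
Qed.

Lemma truncn_binary_digits n x : 0 <= x < 1 ->
  Num.truncn (2 ^+ n * x) = binary_value (mkseq (binary_digits x) n).
Proof.
move=> /andP[x0 x1]; elim: n => [|n ih].
  by rewrite expr0 mul1r; apply: truncn_def; rewrite x0.
rewrite mkseqS binary_value_rcons -ih.
rewrite -[Num.truncn (2 ^+ n * x)]truncn_half ?mulr_ge0 ?exprn_ge0//.
rewrite mulrA -exprS addnC /binary_digits.
by rewrite odd_double_half.
Qed.

Lemma preimage_binary_digits t :
  (binary_digits @^-1` cylinder t) `&` `[0, 1[%classic =
  `[(binary_value t)%:R / 2 ^+ size t,
    (binary_value t).+1%:R / 2 ^+ size t[%classic.
Proof.
have p0 : 0 < 2 ^+ size t :> R by rewrite exprn_gt0.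
apply/seteqP; split => x /=; rewrite !in_itv/= ler_pdivrMr// ltr_pdivlMr//.
  move=> [/cylinderE tx x01]; rewrite mulrC -truncn_eq.
    by rewrite truncn_binary_digits// tx.
  by case/andP: x01 => x0 _; rewrite mulr_ge0// ltW.
move=> /andP[l u].
have x0 : 0 <= x by rewrite -(pmulr_lge0 _ p0) (le_trans _ l).
have x1 : x < 1.
  rewrite -(ltr_pM2r p0) mul1r (lt_le_trans u)// -natrX ler_nat.
  exact: binary_value_lt.
split; last by rewrite x0.
apply/cylinderE; apply: binary_value_inj; first by rewrite size_mkseq.
rewrite -truncn_binary_digits ?x0//; apply: truncn_def.
by rewrite mulrC l.
Qed.

Lemma measurable_truncn_gt (k n : nat) :
  measurable [set x : measurableTypeR R | (k < Num.truncn (2 ^+ n * x))%N].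
Proof.
have -> : [set x : R | (k < Num.truncn (2 ^+ n * x))%N] =
    `[k.+1%:R / 2 ^+ n, +oo[%classic.
  apply/seteqP; split=> x /=; rewrite truncn_gt_nat in_itv/= andbT.
    by rewrite ler_pdivrMr ?exprn_gt0// mulrC.
  by rewrite ler_pdivrMr ?exprn_gt0// mulrC.
exact: measurable_itv.
Qed.

Lemma measurable_binary_digit n (b : bool) :
  measurable [set x : measurableTypeR R | binary_digits x n = b].
Proof.
have mt : measurable [set x : measurableTypeR R | binary_digits x n].
  rewrite [X in measurable X](_ : _ = \bigcup_k
      ([set x : R | (k.*2 < Num.truncn (2 ^+ n.+1 * x))%N] `\`
       [set x : R | (k.*2.+1 < Num.truncn (2 ^+ n.+1 * x))%N])).
    by apply: bigcupT_measurable => k; apply: measurableD;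
      exact: measurable_truncn_gt.
  apply/seteqP; split => x /=; rewrite /binary_digits.
    move=> om; exists (Num.truncn (2 ^+ n.+1 * x))./2 => //=.
    move: (Num.truncn _) om => m om.
    have h : m = (m./2).*2.+1 by rewrite -{1}(odd_double_half m) om.
    by split; [rewrite [ltnRHS]h|apply/negP; rewrite -leqNgt {1}h].
  move=> [k _ /=]; move: (Num.truncn _) => m [km /negP mk].
  have -> : m = k.*2.+1 by lia.
  by rewrite /= odd_double.
case: b; first exact: mt.
rewrite [X in measurable X](_ : _ = ~` [set x : R | binary_digits x n]).
  exact: measurableC.
by apply/seteqP; split => x /=; [move=> -> | move/negP/negbTE].
Qed.

Lemma measurable_binary_digits :
  measurable_fun [set: measurableTypeR R] (binary_digits : R -> borel_cantor).
Proof.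
apply: (@measurability _ _ _ borel_cantor _ _ (range cylinder)
  sigma_cylinder) => _ [_ [t _ <-] <-].
rewrite setTI [X in measurable X](_ : _ = \bigcap_(i in `I_(size t))
    [set x : R | binary_digits x i = nth false t i]).
  by apply: bigcap_measurableType => i _; exact: measurable_binary_digit.
by apply/seteqP; split => f h i /h.
Qed.

End binary_expansion.

(* Binary expansion maps the uniform measure on [0, 1[ to the fair coin measure;
   this construction serves only to prove that the latter exists. *)
Section fair_coin.
Variable R : realType.
Local Open Scope ereal_scope.

Let measurable_I01 : measurable (`[0%R, 1%R[%classic : set (measurableTypeR R)).
Proof. exact: measurable_itv. Qed.

Definition uniform01 : set (measurableTypeR R) -> \bar R :=
  mrestr (@lebesgue_measure R) measurable_I01.

#[local] HB.instance Definition _ := Measure.on uniform01.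

Let uniform01_setT : uniform01 setT = 1.
Proof.
by rewrite /uniform01 /mrestr setTI lebesgue_measure_itv/= lte_fin ltr01 sube0.
Qed.

#[local] HB.instance Definition _ :=
  Measure_isProbability.Build _ _ _ uniform01 uniform01_setT.

Let expansion : measurableTypeR R -> borel_cantor := @binary_digits R.

#[local] HB.instance Definition _ := isMeasurableFun.Build _ _ _ _ expansion
  (@measurable_binary_digits R).

Lemma fair_coin_exists : exists P : probability borel_cantor R,
  forall t, P (cylinder t) = (2 ^- size t)%:E.
Proof.
exists (distribution uniform01 expansion) => t.
rewrite /distribution /pushforward /= /uniform01 /mrestr /expansion.
rewrite preimage_binary_digits lebesgue_measure_itv/=.
rewrite lte_fin ltr_pM2r ?invr_gt0 ?exprn_gt0// ltr_nat ltnSn -EFinB.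
by rewrite -mulrBl -natrB// subSnn mul1r.
Qed.

Definition fair_coin : probability borel_cantor R := sval (cid fair_coin_exists).

Lemma fair_coinE t : fair_coin (cylinder t) = (2 ^- size t)%:E.
Proof. exact: (svalP (cid fair_coin_exists)). Qed.

Lemma fair_coin_unique (P : {measure set borel_cantor -> \bar R}) :
  (forall t, P (cylinder t) = (2 ^- size t)%:E) ->
  forall A : set borel_cantor, measurable A -> P A = fair_coin A.
Proof.
move=> PE A mA.
pose G := set0 |` range cylinder.
have sG : <<s @open cantor_space >> = <<s G >>.
  rewrite sigma_cylinder; apply/seteqP; split.
    by apply: sub_sigma_algebra2; exact: subsetUr.
  apply: smallest_sub; first exact: smallest_sigma_algebra.
  move=> B [->|]; first exact: sigma_algebra0.
  exact: sub_sigma_algebra.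
have c0 : cylinder [::] = setT by apply/seteqP; split.
apply: (@measure_unique _ _ borel_cantor G (fun=> setT) sG) => //.
- move=> B C [->|[s _ <-]] [->|[t _ <-]];
    rewrite ?set0I ?setI0; try by left.
  wlog st : s t / (size s <= size t)%N.
    by move=> h; case/orP: (leq_total (size s) (size t)) => /h //; rewrite setIC.
  have [ts|ts] := eqVneq (take (size s) t) s.
    right; exists t => //; apply/seteqP; split => [f tf|f []//].
    split=> //  i si; rewrite tf ?(leq_trans si)//.
    by rewrite -[in RHS]ts nth_take.
  left; apply/seteqP; split => // f [/cylinderE sf /cylinderE tf].
  move/eqP: ts; apply; rewrite -tf -[in RHS]sf.
  by rewrite /mkseq -map_take take_iota (minn_idPl st).
- by move=> _; right; exists [::].
- by rewrite bigcup_const//; exists 0%N.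
- by move=> B [->|[t _ <-]]; [rewrite !measure0|rewrite PE; exact/esym/fair_coinE].
- by move=> _; rewrite -c0 PE ltry.
Qed.

End fair_coin.

(* Main.v *)
Require Import Defs.
From mathcomp Require Import all_boot all_order all_algebra.
From mathcomp Require Import zify.
From mathcomp Require Import all_classical all_reals all_analysis.

(** Read a real [X] as a two-dimensional random walk: the bits of [X] at even
    places drive one coordinate and those at odd places the other, a bit being
    a step up or down.  That [X] is guessed at [n] says that both coordinates
    are at the origin after [n] bits, so the probabilistic assertion is the
    recurrence of this walk, and it is proved by Feller's renewal argument.

    Balance at time [m] is a renewal: [m] is then a multiple of 4, hence even,
    so dropping the first [m] bits preserves parities, and balance at time
    [m + k] amounts to balance of the shifted real at time [k]
    ([balanced_quarter_renewal]).  Moreover the shifted real is again a fair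
    coin sequence independent of the first [m] bits
    ([fair_coin_occurs_shift]).  So, if [u m] is the probability of balance at
    time [m] and [q] that of never being balanced at a positive time, then the
    last time of balance equals [m] with probability [u m * q].  These events
    are disjoint, whence [q * \sum_(m < N) u m <= 1] for all [N]; if the series
    of the [u m] diverges, then [q = 0] and almost surely there is no last time
    of balance ([fair_coin_guessed_reals]).

    A balanced set consists of half of the even places and half of the odd
    ones, chosen independently, which gives the cardinal
    ([card_balanced_quarter]).  For [m > 0] the bound
    [16 ^ m <= 4 * m * 'C(2 * m, m) ^ 2] ([leq_central_binomial]) then yields
    [u (4 * m) >= 1 / (4 * m)], so that the series of the [u m] dominates a harmonic series
    ([dvg_balanced_quarter]). *)

Set Implicit Arguments.
Unset Strict Implicit.
Unset Printing Implicit Defensive.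

Import Order.TTheory GRing.Theory Num.Theory.
Import numFieldNormedType.Exports.

Local Open Scope ring_scope.

(** * Counting balanced sets *)

(** [X] is recovered from its two traces as their union, so choosing [X] is the
    same as choosing the traces independently. *)
Lemma card_draws_setC (T : finType) (E : {set T}) (a b : nat) :
  #|[set X : {set T} | (#|X :&: E| == a) && (#|X :&: ~: E| == b)]| =
  ('C(#|E|, a) * 'C(#|~: E|, b))%N.
Proof.
pose P k (F : {set T}) := [set Y : {set T} | Y \subset F & #|Y| == k].
have parts (Y Z : {set T}) : Y \subset E -> Z \subset ~: E ->
    (Y :|: Z) :&: E = Y /\ (Y :|: Z) :&: ~: E = Z.
  move=> /fintype.subsetP YE /fintype.subsetP ZE.
  split; apply/setP => x; move/implyP: (ZE x); move/implyP: (YE x);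
    by rewrite !inE; case: (x \in Y); case: (x \in Z); case: (x \in E).
rewrite -!cards_draws -/(P a E) -/(P b (~: E)) -cardsX.
rewrite -(@card_in_imset _ _ (fun p => p.1 :|: p.2)); last first.
  move=> [Y Z] [Y' Z']; rewrite !inE/= => /andP[/andP[YE _] /andP[ZE _]].
  move=> /andP[/andP[YE' _] /andP[ZE' _]] YZ.
  have [eY eZ] := parts _ _ YE ZE; have [eY' eZ'] := parts _ _ YE' ZE'.
  by congr (_, _); [rewrite -eY YZ|rewrite -eZ YZ].
apply: (congr1 (fun A : {set {set T}} => #|A|)); apply/setP => X.
rewrite inE; apply/idP/imsetP.
  move=> /andP[Xa Xb]; exists (X :&: E, X :&: ~: E).
    by rewrite !inE/= !finset.subsetIr Xa Xb.
  by rewrite /= -finset.setIUr finset.setUCr finset.setIT.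
move=> [[Y Z]]; rewrite !inE/= => /andP[/andP[YE Ya] /andP[ZE Zb]] ->.
by have [-> ->] := parts _ _ YE ZE; rewrite Ya.
Qed.

Lemma card_ord_parity n (b : bool) : #|[set i : 'I_n.*2 | odd i == b]| = n.
Proof.
rewrite -sum1_card big_mkcond/=.
under eq_bigr do rewrite inE.
elim: n => [|n ih]; first by rewrite big_ord0.
rewrite doubleS !big_ord_recr/= ih/= odd_double.
by case: (b); rewrite /= ?addn0 addn1.
Qed.

(** Multiplying the rational equations by 4 turns them into equations between
    natural numbers that hold only when 4 divides [n]; indexing the two classes
    by the parity [b] allows both to be treated at once. *)
Lemma in_balanced_quarter n (S : {set 'I_n}) : (S \in balanced_quarter n) =
  [forall b : bool, (4 * #|S :&: [set i : 'I_n | odd i == b]| == n)%N].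
Proof.
have E (k : nat) : (k%:R == n%:R / 4 :> rat) = (4 * k == n)%N.
  by rewrite -(inj_eq (mulfI (_ : 4 != 0 :> rat)))// mulrCA divff// mulr1
     -natrM eqr_nat.
rewrite inE E [X in _ && X]eq_sym E.
have -> : [set i : 'I_n | ~~ odd i] = [set i : 'I_n | odd i == false].
  by apply/setP => i; rewrite !inE eqbF_neg.
have -> : [set i : 'I_n | odd i] = [set i : 'I_n | odd i == true].
  by apply/setP => i; rewrite !inE eqb_id.
by apply/andP/forallP => [[h0 h1] []|h].
Qed.

Lemma balanced_quarter_eq0 n : ~~ (4 %| n)%N ->
  balanced_quarter n = finset.set0.
Proof.
move=> n4; apply/setP => S; rewrite in_balanced_quarter inE.
apply/negbTE/negP => /forallP/(_ true)/eqP n4'.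
by rewrite -n4' dvdn_mulr in n4.
Qed.

Lemma card_balanced_quarter n : (4 %| n)%N ->
  #|balanced_quarter n| = ('C(n %/ 2, n %/ 4) ^ 2)%N.
Proof.
move=> /dvdnP[k ->{n}]; rewrite mulnK//.
have -> : (k * 4 %/ 2 = k.*2)%N by lia.
have -> : (k * 4 = k.*2.*2)%N by lia.
pose E := [set i : 'I_k.*2.*2 | odd i == true].
have EC : ~: E = [set i : 'I_k.*2.*2 | odd i == false].
  by apply/setP => i; rewrite !inE eqb_id eqbF_neg.
transitivity ('C(#|E|, k) * 'C(#|~: E|, k))%N; last first.
  by rewrite EC !card_ord_parity mulnn.
rewrite -card_draws_setC.
apply: (congr1 (fun A : {set {set 'I_k.*2.*2}} => #|A|)); apply/setP => S.
rewrite in_balanced_quarter inE EC.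
have k4 j : (4 * j == k.*2.*2)%N = (j == k) by lia.
apply/forallP/andP => [h|[h0 h1] b]; last by rewrite k4; case: b.
by have := h true; have := h false; rewrite !k4.
Qed.

(** The induction step, from [m + 1] to [m + 2], multiplies the left side by 16
    and the right side by [4 * (2 * m + 3) ^ 2 / ((m + 1) * (m + 2))], which is
    at least 16 because [(2 * m + 3) ^ 2 = 4 * (m + 1) * (m + 2) + 1]. *)
Lemma leq_central_binomial m : (0 < m)%N ->
  (16 ^ m <= 4 * m * 'C(m.*2, m) ^ 2)%N.
Proof.
case: m => // m _; elim: m => // m ih.
have step : (m.+2 * 'C(m.+2.*2, m.+2) = 2 * m.*2.+3 * 'C(m.+1.*2, m.+1))%N.
  rewrite !doubleS -mul_bin_diag/= -mulnA (mul_bin_down m.*2.+3).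
  have -> : (m.*2.+3 - m.+1 = m.+2)%N by lia.
  by rewrite mulnA; congr muln; lia.
(* With the factor [m.+2] already there, this provides one for each of the
   two binomials in the square, as [step] requires. *)
rewrite -(leq_pmul2l (ltn0Sn m.+1)).
have -> : (m.+2 * (4 * m.+2 * 'C(m.+2.*2, m.+2) ^ 2) =
    4 * (m.+2 * 'C(m.+2.*2, m.+2)) ^ 2)%N by lia.
rewrite step expnS; nia.
Qed.

Local Open Scope classical_set_scope.

(** * Shifting a fair coin sequence *)

Definition shift (m : nat) (X : borel_cantor) : borel_cantor :=
  fun i => (X : cantor_space) (m + i)%N.

Lemma measurable_coord (i : nat) (b : bool) :
  measurable ([set X | (X : cantor_space) i = b] : set borel_cantor).
Proof. by apply: sub_sigma_algebra; exact: open_coord. Qed.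

Lemma measurable_shift m : measurable_fun setT (shift m).
Proof.
apply: (@measurability _ _ _ borel_cantor _ _ (range cylinder)
  sigma_cylinder) => _ [_ [t _ <-] <-].
rewrite setTI [X in measurable X](_ : _ = \bigcap_(i in `I_(size t))
    [set X | (X : cantor_space) (m + i)%N = nth false t i]).
  by apply: bigcap_measurableType => i _; exact: measurable_coord.
by apply/seteqP; split => f h i /h.
Qed.

Lemma cylinder_cat s t :
  cylinder s `&` shift (size s) @^-1` cylinder t = cylinder (s ++ t).
Proof.
apply/seteqP; split => [f [hs ht] i|f h].
  rewrite size_cat nth_cat => ist; case: ltnP => [|si]; first exact: hs.
  have := ht (i - size s)%N; rewrite /shift subnKC// => -> //.
  by rewrite ltn_subLR.
split=> i it; first by rewrite h ?size_cat ?ltn_addr// nth_cat it.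
rewrite /shift h ?size_cat ?ltn_add2l// nth_cat.
by rewrite ltnNge leq_addr/= addKn.
Qed.

Section fair_coin_theory.
Variable R : realType.
Local Open Scope ereal_scope.

(** Independence of the first bits from the later ones.  The fair coin measure
    is determined by its values on cylinders, so it suffices to see that
    conditioning on [cylinder s] and forgetting these bits is again a measure
    with the same values on cylinders, which is [cylinder_cat]. *)
Lemma fair_coin_cylinder_shift s (B : set borel_cantor) : measurable B ->
  fair_coin R (cylinder s `&` shift (size s) @^-1` B) =
  (2 ^- size s)%:E * fair_coin R B.
Proof.
move=> mB.
have p0 : (0 < 2 ^+ size s :> R)%R by rewrite exprn_gt0.
have /(_ (measurable_shift _)) unique := @fair_coin_unique R
  (mscale (NngNum (ltW p0)) (pushforward
    (mrestr (fair_coin R) (measurable_cylinder s)) (shift (size s)))).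
rewrite -(unique _ B mB) => [|t]; rewrite /= /mscale/= /pushforward /mrestr setIC.
  by rewrite muleA -EFinM mulVf ?mul1e ?gt_eqF.
rewrite cylinder_cat fair_coinE.
by rewrite size_cat exprD invfM -EFinM mulrA divff ?mul1r ?gt_eqF.
Qed.

End fair_coin_theory.

(** * Initial segments as events *)

Lemma infinite_natP (A : set nat) :
  infinite_set A <-> forall n, exists2 k, (n <= k)%N & A k.
Proof.
split=> [iA n|hA /finite_seqP[s As]].
  have [//|/forall2NP nA] := pselect (exists2 k, (n <= k)%N & A k).
  exfalso; apply: iA; apply: (sub_finite_set _ (finite_II n)) => k Ak /=.
  by have [/negP|//] := nA k; rewrite -ltnNge.
have [k] := hA (\max_(i <- s) i).+1.
rewrite As ltnNge => /negP + /= ks; apply.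
exact: (@leq_bigmax_seq _ _ xpredT id).
Qed.

Definition occurs (A : forall n, {set {set 'I_n}}) (n : nat) :
  set borel_cantor := [set X | initial_segment X n \in A n].

(** The event that the initial segment is [S] is the cylinder over the bits
    of [S]; this is how sets of initial segments receive a probability. *)
Definition segment_word n (S : {set 'I_n}) : seq bool :=
  [seq i \in S | i <- enum 'I_n].

Lemma size_segment_word n (S : {set 'I_n}) : size (segment_word S) = n.
Proof. by rewrite size_map size_enum_ord. Qed.

Lemma cylinder_segment_word n (S : {set 'I_n}) :
  cylinder (segment_word S) = [set X | initial_segment X n = S].
Proof.
have nthS (i : 'I_n) : nth false (segment_word S) i = (i \in S).
  by rewrite (nth_map i) ?size_enum_ord// nth_ord_enum.
apply/seteqP; split => X /=; rewrite /cylinder/= size_segment_word => h.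
  by apply/setP => i; rewrite inE h// nthS.
by move=> i im; rewrite (nthS (Ordinal im)) -h inE.
Qed.

Lemma occurs_bigcup A n :
  occurs A n = \bigcup_(S in [set` enum (A n)]) cylinder (segment_word S).
Proof.
apply/seteqP; split => [X AX|X [S AS]].
  by exists (initial_segment X n); rewrite ?cylinder_segment_word//= mem_enum.
by rewrite cylinder_segment_word /occurs/= => ->; rewrite -mem_enum.
Qed.

Lemma measurable_occurs A n : measurable (occurs A n).
Proof.
rewrite occurs_bigcup; apply: fin_bigcup_measurable => // S _.
exact: measurable_cylinder.
Qed.

Lemma guessed_realsE A : guessed_reals A = lim_sup_set (occurs A).
Proof.
apply/seteqP; split => X.
  by move=> /infinite_natP h n _; have [k nk Ak] := h n; exists k.
by move=> h; apply/infinite_natP => n; have [k nk Ak] := h n I; exists k.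
Qed.

Lemma measurable_guessed_reals A :
  measurable (guessed_reals A : set borel_cantor).
Proof.
rewrite guessed_realsE; apply: bigcapT_measurable => n.
by apply: bigcup_measurable => k _; exact: measurable_occurs.
Qed.

(** * Recurrence of renewal events *)

Section recurrence.
Variables (R : realType) (A : forall n, {set {set 'I_n}}).
Local Open Scope ereal_scope.

Definition occurrence_prob (n : nat) : R := (#|A n|%:R / 2 ^+ n)%R.

(** The event is a finite disjoint union of cylinders on the first [n] bits,
    and the later bits are independent of each of these. *)
Lemma fair_coin_occurs_shift n (B : set borel_cantor) : measurable B ->
  fair_coin R (occurs A n `&` shift n @^-1` B) =
  (occurrence_prob n)%:E * fair_coin R B.
Proof.
move=> mB; have mS : measurable (shift n @^-1` B).
  by rewrite -[X in measurable X]setTI; exact: measurable_shift.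
rewrite occurs_bigcup setI_bigcupl measure_fin_bigcup//; last 2 first.
- apply/trivIsetP => S T _ _ /eqP ST; rewrite !cylinder_segment_word.
  by apply/seteqP; split => // X [[/= XS _] [/= XT _]]; apply: ST; rewrite -XS.
- by move=> S _; apply: measurableI => //; exact: measurable_cylinder.
rewrite -fsbig_seq ?enum_uniq// big_enum/=.
transitivity (\sum_(S in A n) (2 ^- n)%:E * fair_coin R B).
  apply: eq_bigr => S _.
  by have := fair_coin_cylinder_shift R (segment_word S) mB;
    rewrite size_segment_word.
rewrite -ge0_sume_distrl; last by move=> S _; rewrite lee_fin invr_ge0 exprn_ge0.
by rewrite sumEFin sumr_const /occurrence_prob mulr_natl.
Qed.

Definition no_return : set borel_cantor := ~` \bigcup_k occurs A k.+1.

Lemma measurable_no_return : measurable no_return.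
Proof.
apply: measurableC; apply: bigcupT_measurable => k; exact: measurable_occurs.
Qed.

(** This says that the last occurrence is at [n] only for renewal events, see
    [last_occurrenceP]; the present form exhibits an event about the first [n]
    bits and one about the shifted real, which are independent. *)
Definition last_occurrence n : set borel_cantor :=
  occurs A n `&` shift n @^-1` no_return.

Lemma measurable_last_occurrence n : measurable (last_occurrence n).
Proof.
apply: measurableI; first exact: measurable_occurs.
by rewrite -[X in measurable X]setTI; apply: measurable_shift => //;
  exact: measurable_no_return.
Qed.

Hypothesis A0 : forall X : borel_cantor, occurs A 0 X.
(* Once the event has occurred, everything starts afresh. *)
Hypothesis renewal : forall m k (X : borel_cantor), occurs A m X ->
  occurs A (m + k) X <-> occurs A k (shift m X).

Lemma last_occurrenceP n X : last_occurrence n X <->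
  occurs A n X /\ forall k, (n < k)%N -> ~ occurs A k X.
Proof.
split=> -[AX h]; split=> //.
  move=> k nk AkX; apply: h; exists (k - n).-1 => //.
  rewrite prednK ?subn_gt0//.
  by apply/(renewal _ AX); rewrite subnKC// ltnW.
move=> [k _] /(renewal _ AX); apply: h; lia.
Qed.

Lemma trivIset_last_occurrence : trivIset setT last_occurrence.
Proof.
apply/trivIsetP => i j _ _ /eqP ij; apply/seteqP; split => // X.
move=> [/last_occurrenceP[iX hi] /last_occurrenceP[jX hj]].
by case: (ltngtP i j) => // ?; [apply: (hi j)|apply: (hj i)].
Qed.

(** As the event occurs at time 0, finitely many occurrences always include a
    last one. *)
Lemma setC_guessed_reals :
  ~` guessed_reals A = \bigcup_n last_occurrence n.
Proof.
apply/seteqP; split => X; rewrite guessed_realsE.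
  move=> nX.
  have [m mX] : exists m, forall k, (m <= k)%N -> ~ occurs A k X.
    apply: contrapT => /forallNP h; apply: nX => n _.
    apply: contrapT => nXn; apply: (h n) => k nk kX.
    by apply: nXn; exists k.
  have ex : exists k, `[< occurs A k X >].
    by exists 0%N; exact/asboolP.
  have ub k : `[< occurs A k X >] -> (k <= m)%N.
    by move=> /asboolP kX; rewrite leqNgt; apply/negP => /ltnW/mX.
  case: (ex_maxnP ex ub) => n /asboolP AX nmax.
  exists n => //; apply/last_occurrenceP; split=> // k nk /asboolP/nmax.
  by rewrite leqNgt nk.
by move=> [n _ /last_occurrenceP[nX h]] /(_ n.+1 I) [k /h].
Qed.

(** The events [last_occurrence n] are disjoint, of probability
    [occurrence_prob n * q] where [q] is the probability of no return.  If [q]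
    were positive, [1 / q] would bound the partial sums of a divergent series
    of nonnegative terms; so all of these events are null. *)
Lemma fair_coin_guessed_reals : ~ cvgn (series occurrence_prob) ->
  fair_coin R (guessed_reals A) = 1.
Proof.
move=> dvg.
have P0 : fair_coin R no_return = 0.
  apply: contrapT => /eqP P0; apply: dvg.
  have : fair_coin R no_return \is a fin_num.
    by apply: fin_num_measure; exact: measurable_no_return.
  have : 0 <= fair_coin R no_return by [].
  move: P0; case E : (fair_coin R no_return) => [q| |]//.
  move=> q0; rewrite lee_fin => q_ge0 _.
  have {q0} q_gt0 : (0 < q)%R.
    by rewrite lt_neqAle q_ge0 andbT eq_sym.
  apply: nondecreasing_is_cvgn.
    apply/nondecreasing_series => n _ _; rewrite /occurrence_prob.
    by rewrite divr_ge0 ?exprn_ge0.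
  exists (q^-1)%R => _ [N _ <-].
  rewrite -[leRHS]mul1r ler_pdivlMr// -lee_fin.
  have <- : fair_coin R (\big[setU/set0]_(n < N) last_occurrence n) =
      (series occurrence_prob N * q)%:E.
    rewrite measure_bigsetU//; last 2 first.
    - exact: measurable_last_occurrence.
    - exact: trivIset_last_occurrence.
    rewrite /series/= big_mkord mulr_suml -sumEFin; apply: eq_bigr => n _.
    by rewrite fair_coin_occurs_shift ?E//; exact: measurable_no_return.
  apply: probability_le1; apply: bigsetU_measurable => n _.
  exact: measurable_last_occurrence.
rewrite -[guessed_reals A]setCK setC_guessed_reals probability_setC.
  rewrite measure_bigcup//=.
  - rewrite eseries0 ?sube0// => n _ _.
    rewrite fair_coin_occurs_shift ?P0 ?mule0//; exact: measurable_no_return.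
  - by move=> n _; exact: measurable_last_occurrence.
  - exact: trivIset_last_occurrence.
by apply: bigcupT_measurable => n; exact: measurable_last_occurrence.
Qed.

End recurrence.

(** * The balanced event *)

Definition parity_count (X : nat -> bool) (n : nat) (b : bool) : nat :=
  \sum_(i < n) (X i && (odd i == b)).

Lemma parity_countD X m k b : ~~ odd m ->
  parity_count X (m + k) b =
  (parity_count X m b + parity_count (fun i => X (m + i)%N) k b)%N.
Proof.
move=> /negbTE m0; rewrite /parity_count big_split_ord/=; congr addn.
by apply: eq_bigr => i _; rewrite oddD m0.
Qed.

Lemma occurs_balanced_quarter n X : occurs balanced_quarter n X <->
  forall b, (4 * parity_count X n b)%N = n.
Proof.
have cE b : #|initial_segment X n :&: [set i : 'I_n | odd i == b]| =
    parity_count X n b.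
  rewrite -sum1_card big_mkcond; apply: eq_bigr => i _.
  by rewrite !inE; case: ifP.
rewrite /occurs/= in_balanced_quarter.
split=> [/forallP h b|h]; first by rewrite -cE; exact/eqP.
by apply/forallP => b; rewrite cE h.
Qed.

(** Balance at [m] forces [m] to be even, so that shifting by [m] does not
    exchange the two parity classes. *)
Lemma balanced_quarter_renewal m k X : occurs balanced_quarter m X ->
  occurs balanced_quarter (m + k) X <-> occurs balanced_quarter k (shift m X).
Proof.
move=> /occurs_balanced_quarter mX.
have m0 : ~~ odd m by rewrite -(mX true) oddM.
split=> /occurs_balanced_quarter kX; apply/occurs_balanced_quarter => b.
  by have := kX b; rewrite parity_countD// mulnDr mX => /addnI.
by rewrite parity_countD// mulnDr mX kX.
Qed.

(** Only the times [4 * k.+1] matter: there the probability is at least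
    [1 / (4 * k.+1)]. *)
Lemma dvg_balanced_quarter (R : realType) :
  ~ cvgn (series (occurrence_prob R balanced_quarter)).
Proof.
set u := occurrence_prob R balanced_quarter => cu.
have u0 n : 0 <= u n by rewrite divr_ge0 ?exprn_ge0.
have nd : nondecreasing_seq (series u) by apply/nondecreasing_series => *.
have uh k : harmonic k <= 4 * u (4 * k.+1)%N.
  rewrite /u /occurrence_prob card_balanced_quarter ?dvdn_mulr//.
  have -> : (4 * k.+1 %/ 2 = k.+1.*2)%N by lia.
  rewrite mulKn// /harmonic/= mulrA ler_pdivlMr ?exprn_gt0// ler_pdivrMl//.
  rewrite exprM -!natrX -!natrM ler_nat.
  by have := leq_central_binomial (ltn0Sn k); rewrite (_ : 2 ^ 4 = 16)%N//; nia.
have hu N : series harmonic N <= 4 * series u (4 * N).+1.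
  elim: N => [|N ih].
    by rewrite /series/= big_geq// mulr_ge0// sumr_ge0.
  rewrite seriesSr [series u _]seriesSr mulrDr lerD//.
  by apply: (le_trans ih); rewrite ler_pM2l//; apply: nd; lia.
apply: (@dvg_harmonic R); apply: nondecreasing_is_cvgn.
  by apply/nondecreasing_series => n _ _; rewrite ltW ?harmonic_gt0.
exists (4 * limn (series u)) => _ [N _ <-].
apply: (le_trans (hu N)); rewrite ler_pM2l//.
exact: nondecreasing_cvgn_le.
Qed.

Theorem proposition4p8 (R : realType) :
  [/\ forall n, ~~ (4 %| n)%N -> balanced_quarter n = finset.set0,
      forall n, (4 %| n)%N ->
        #|balanced_quarter n| = ('C(n %/ 2, n %/ 4) ^ 2)%N,
      measurable (guessed_reals balanced_quarter : set borel_cantor) &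
      fair_coin R (guessed_reals balanced_quarter) = 1%E].
Proof.
split; [exact: balanced_quarter_eq0|exact: card_balanced_quarter| |].
  exact: measurable_guessed_reals.
apply: fair_coin_guessed_reals.
- move=> X; apply/occurs_balanced_quarter => b.
  by rewrite /parity_count big_ord0.
- exact: balanced_quarter_renewal.
- exact: dvg_balanced_quarter.
Qed.
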